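(* Let $1<p\leq\infty$, let $q=p/(p-1)$ if $p<\infty$ and $q=1$ if $p=\infty$, and let $\upsilon=\{\upsilon_n\}_{n\in\mathbb{Z}}\in\ell^{p}(\mathbb{Z})$ be a complex sequence. Let $H_V=H_0+V$ be the associated discrete Schrödinger operator on $\ell^2(\mathbb{Z})$. Then $$\sigma(H_V)\subset\bigg\{k+\frac1k\ \bigg|\ k\in\mathbb{C}\setminus\{0\},\ |k|\leq1\ \text{ and }\ \bigg|k-\frac1k\bigg|\bigg(\frac{1-|k|^q}{1+|k|^q}\bigg)^{1/q}\leq\|\upsilon\|_{\ell^p(\mathbb{Z})}\bigg\}.$$
   Context: $\{e_n\}_{n\in\mathbb{Z}}$ is the standard basis of the complex Hilbert space $\ell^2(\mathbb{Z})$. The discrete Laplacian $H_0$ is the bounded operator on $\ell^2(\mathbb{Z})$ determined by $H_0e_n=e_{n-1}+e_{n+1}$ for all $n\in\mathbb{Z}$. For a bounded complex sequence $\upsilon=\{\upsilon_n\}_{n\in\mathbb{Z}}$, the potential $V$ is the diagonal operator $Ve_n=\upsilon_ne_n$, $n\in\mathbb{Z}$, and $H_V:=H_0+V$. $\sigma(H_V)$ denotes the spectrum of the bounded operator $H_V$. *)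

(* Defs.v *)
From HB Require Import structures.
From mathcomp Require Import all_boot all_order all_algebra.
From mathcomp Require Import ring lra.
From mathcomp Require Import finmap.
From mathcomp Require Import complex.
From mathcomp Require Import all_classical all_reals all_analysis.

Set Implicit Arguments.
Unset Strict Implicit.
Unset Printing Implicit Defensive.

Import Order.TTheory GRing.Theory Num.Theory.
Import numFieldNormedType.Exports.
Import ComplexField.Normc.

Local Open Scope classical_set_scope.
Local Open Scope ring_scope.

Section lp_norm.
Context {R : realType}.
Implicit Types (p : \bar R) (x y v : int -> R[i]).

(* Meaningful for 1 <= p only.  [normc] is the modulus with values in R (the
   norm of the numeric field R[i] takes its values in R[i]). *)
Definition lpnorm p v : \bar R :=
  match p with
  | r%:E => ((\esum_(n in [set: int]) ((normc (v n)) `^ r)%:E) `^ r^-1)%E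
  | +oo%E => ereal_sup [set (normc (v n))%:E | n in [set: int]]
  | -oo%E => 0%E
  end.

Definition lp p : {pred int -> R[i]} := [pred v | (lpnorm p v < +oo)%E].

Lemma in_lp p v : (v \in lp p) = (lpnorm p v < +oo)%E. Proof. by []. Qed.

Definition conj_exponent p : R :=
  if p is r%:E then r / (r - 1) else 1.

Let sq x : \bar R := (\esum_(n in [set: int]) (normc (x n) ^+ 2)%:E)%E.

Lemma normc_ge0 (z : R[i]) : 0 <= normc z.
Proof. by case: z => a b; exact: sqrtr_ge0. Qed.

Let sq_ge0 x : (0 <= sq x)%E.
Proof. by apply: esum_ge0 => n _; rewrite lee_fin sqr_ge0. Qed.

Let lpnorm2E x : lpnorm 2%:E x = (sq x `^ 2^-1)%E.
Proof.
rewrite /lpnorm; congr (_ `^ _)%E; apply: eq_esum => n _.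
by rewrite powR_mulrn// normc_ge0.
Qed.

Let sum_le_sq x (s : seq int) : uniq s ->
  ((\sum_(n <- s) normc (x n) ^+ 2)%:E <= sq x)%E.
Proof.
move=> us; apply: esum_ge; exists [set` s]; first by split => //; exact: finite_seq.
by rewrite -fsbig_seq// sumEFin.
Qed.

Let sq_le x (M : R) :
  (forall s : seq int, uniq s -> \sum_(n <- s) normc (x n) ^+ 2 <= M) ->
  (sq x <= M%:E)%E.
Proof.
move=> h; apply: ge_ereal_sup => _ [X [finX _] <-].
by rewrite fsbig_finite//= sumEFin lee_fin; apply/h/fset_uniq.
Qed.

Let lp2E x : (x \in lp 2%:E) = (sq x < +oo)%E.
Proof.
rewrite in_lp lpnorm2E; apply/idP/idP; last exact: poweR_lty.
by apply: lty_poweRy; rewrite invr_eq0.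
Qed.

Definition l2norm x : R := fine (lpnorm 2%:E x).

Lemma l2norm_ge0 x : 0 <= l2norm x.
Proof. by rewrite /l2norm lpnorm2E fine_ge0// poweR_ge0. Qed.

Let sqr_l2norm x : x \in lp 2%:E -> (l2norm x ^+ 2)%:E = sq x.
Proof.
rewrite lp2E /l2norm lpnorm2E => fx.
have : sq x \is a fin_num by rewrite ge0_fin_numE.
move: (sq_ge0 x); case: (sq x) => //= r r0 _.
by rewrite -powR_mulrn ?powR_ge0// -powRrM mulVf// powRr1.
Qed.

Lemma lp2P x (M : R) : 0 <= M ->
  (forall s : seq int, uniq s -> \sum_(n <- s) normc (x n) ^+ 2 <= M ^+ 2) ->
  x \in lp 2%:E /\ l2norm x <= M.
Proof.
move=> M0 /sq_le h; have fx : x \in lp 2%:E.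
  by rewrite lp2E; apply: le_lt_trans h (ltry _).
split=> //; move: h; rewrite -sqr_l2norm// lee_fin.
by rewrite ler_sqr// nnegrE l2norm_ge0.
Qed.

Lemma l2norm_sum x (s : seq int) : x \in lp 2%:E -> uniq s ->
  \sum_(n <- s) normc (x n) ^+ 2 <= l2norm x ^+ 2.
Proof. by move=> fx us; rewrite -lee_fin sqr_l2norm// sum_le_sq. Qed.

Lemma l2norm_coord x n : x \in lp 2%:E -> normc (x n) <= l2norm x.
Proof.
move=> fx; have := @l2norm_sum x [:: n] fx isT.
by rewrite big_seq1 ler_sqr// nnegrE ?normc_ge0 ?l2norm_ge0.
Qed.

Lemma l2norm_eq0 x : x \in lp 2%:E -> l2norm x = 0 -> x = 0.
Proof.
move=> fx x0; apply/funext => n; apply: eq0_normc.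
by apply/eqP; rewrite eq_le normc_ge0 andbT -x0 l2norm_coord.
Qed.

Lemma lp2_0 : (0 : int -> R[i]) \in lp 2%:E.
Proof.
apply: (proj1 (@lp2P _ 0 _ _)) => // s _.
by rewrite big1 ?expr0n// => i _; rewrite [normc _]normc0 expr0n.
Qed.

Lemma lp2_add x y : x \in lp 2%:E -> y \in lp 2%:E ->
  x + y \in lp 2%:E /\ l2norm (x + y) <= l2norm x + l2norm y.
Proof.
move=> fx fy; have [x0|x0] := eqVneq (l2norm x) 0.
  by rewrite (l2norm_eq0 fx x0) add0r lerDr l2norm_ge0.
have [y0|y0] := eqVneq (l2norm y) 0.
  by rewrite (l2norm_eq0 fy y0) addr0 lerDl l2norm_ge0.
have {}x0 : 0 < l2norm x by rewrite lt_def x0 l2norm_ge0.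
have {}y0 : 0 < l2norm y by rewrite lt_def y0 l2norm_ge0.
apply: lp2P => [|s us]; first by rewrite addr_ge0// l2norm_ge0.
set a := l2norm x in x0 *; set b := l2norm y in y0 *.
have hx : \sum_(n <- s) normc (x n) ^+ 2 <= a ^+ 2 by exact: l2norm_sum.
have hy : \sum_(n <- s) normc (y n) ^+ 2 <= b ^+ 2 by exact: l2norm_sum.
have -> : (a + b) ^+ 2 = (1 + b / a) * a ^+ 2 + (1 + a / b) * b ^+ 2.
  by field; rewrite !gt_eqF.
apply: (@le_trans _ _ (\sum_(n <- s) ((1 + b / a) * normc (x n) ^+ 2
    + (1 + a / b) * normc (y n) ^+ 2))); last first.
  rewrite big_split /= -!mulr_sumr lerD// ler_wpM2l//;
  by rewrite addr_ge0// divr_ge0// ltW.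
apply: ler_sum => n _.
have := le_normcD (x n) (y n); rewrite -[_ + y n]/((x + y) n).
have := normc_ge0 ((x + y) n).
move: (normc _) (normc _) (normc _) => w u t t0 tuw.
apply: (@le_trans _ _ ((u + w) ^+ 2)).
  by apply: lerXn2r => //; rewrite nnegrE (le_trans t0).
rewrite -subr_ge0.
have -> : (1 + b / a) * u ^+ 2 + (1 + a / b) * w ^+ 2 - (u + w) ^+ 2
  = (b * u - a * w) ^+ 2 / (a * b) by field; rewrite !gt_eqF.
by rewrite divr_ge0 ?sqr_ge0// mulr_ge0 ?ltW.
Qed.

Lemma lp2_mul v x (C : R) : 0 <= C -> (forall n, normc (v n) <= C) ->
  x \in lp 2%:E ->
  (fun n => v n * x n) \in lp 2%:E /\
  l2norm (fun n => v n * x n) <= C * l2norm x.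
Proof.
move=> C0 vC fx; apply: lp2P => [|s us]; first by rewrite mulr_ge0// l2norm_ge0.
apply: (@le_trans _ _ (\sum_(n <- s) C ^+ 2 * normc (x n) ^+ 2)).
  apply: ler_sum => n _; rewrite normcM exprMn ler_wpM2r ?sqr_ge0//.
  by rewrite lerXn2r ?nnegrE ?normc_ge0.
by rewrite -mulr_sumr exprMn ler_wpM2l ?sqr_ge0// l2norm_sum.
Qed.

Lemma lp2_scale (c : R[i]) x : x \in lp 2%:E ->
  c *: x \in lp 2%:E /\ l2norm (c *: x) = normc c * l2norm x.
Proof.
move=> fx; have le d z : z \in lp 2%:E ->
    d *: z \in lp 2%:E /\ l2norm (d *: z) <= normc d * l2norm z.
  by move=> fz; apply: (@lp2_mul (fun=> d)) => //; exact: normc_ge0.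
have [fcx lecx] := le c x fx; split=> //; apply/eqP; rewrite eq_le lecx/=.
have [->|c0] := eqVneq c 0; first by rewrite [normc _]normc0 mul0r l2norm_ge0.
have [_] := le c^-1 _ fcx; rewrite scalerA mulVf// scale1r normcV.
by rewrite ler_pdivlMl// lt_def normc_ge0 andbT;
   apply: contra_neq c0 => /eq0_normc.
Qed.

Lemma lp2_shift (k : int) x : x \in lp 2%:E ->
  (fun n => x (n + k)) \in lp 2%:E /\ l2norm (fun n => x (n + k)) <= l2norm x.
Proof.
move=> fx; apply: lp2P => [|s us]; first exact: l2norm_ge0.
rewrite -(big_map (fun n => n + k) predT (fun m => normc (x m) ^+ 2)).
by apply: l2norm_sum => //; rewrite map_inj_uniq//; exact: addIr.
Qed.

Lemma lp2_delta (n : int) :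
  (fun m => (m == n)%:R : R[i]) \in lp 2%:E.
Proof.
apply: (proj1 (@lp2P _ 1 _ _)) => // s us; rewrite expr1n.
have [ns|ns] := boolP (n \in s).
  rewrite (bigD1_seq n)// eqxx [normc _]normc1 expr1n.
  rewrite big1 => [|i /negbTE ->]; first by rewrite /= addr0.
  by rewrite [normc _]normc0 expr0n.
rewrite big_seq big1// => i si; case: eqP => [E|_]; last by rewrite [normc _]normc0 expr0n.
by rewrite -E si in ns.
Qed.

Lemma lp_bounded p v : (0 < p)%E -> v \in lp p ->
  exists2 C : R, 0 <= C & forall n, normc (v n) <= C.
Proof.
rewrite in_lp; case: p => [r|_|] //.
  rewrite lte_fin => r0 /lty_poweRy => /(_ (invr_neq0 (lt0r_neq0 r0))).
  set S := (\esum_(_ in _) _)%E => Soo.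
  have term n : ((normc (v n) `^ r)%:E <= S)%E.
    apply: esum_ge; exists [set n]; last by rewrite fsbig_set1.
    by split => //; exact: finite_set1.
  have S0 : (0 <= S)%E by apply: le_trans (term 0); rewrite lee_fin powR_ge0.
  exists (fine S `^ r^-1) => [|n]; first exact: powR_ge0.
  rewrite -[leLHS]powRr1 ?normc_ge0// -[X in _ `^ X](mulfV (lt0r_neq0 r0)).
  rewrite powRrM; apply: ge0_ler_powR.
  - by rewrite invr_ge0 ltW.
  - by rewrite nnegrE powR_ge0.
  - by rewrite nnegrE fine_ge0.
  by rewrite -lee_fin fineK// ge0_fin_numE.
move=> Soo; pose S := lpnorm +oo v.
have term n : ((normc (v n))%:E <= S)%E.
  by apply: ereal_sup_ubound; exists n.
have S0 : (0 <= S)%E by apply: le_trans (term 0); rewrite lee_fin normc_ge0.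
exists (fine S) => [|n]; first exact: fine_ge0.
by rewrite -lee_fin fineK// ge0_fin_numE.
Qed.

End lp_norm.

Record ell2 (R : realType) := Ell2 {
  ell2_fun :> int -> R[i];
  ell2P : ell2_fun \in lp 2%:E }.

Section ell2_structure.
Context {R : realType}.

HB.instance Definition _ := [isSub for @ell2_fun R].
HB.instance Definition _ := [Choice of ell2 R by <:].

Lemma lp2_submod_closed : submod_closed (@lp R 2%:E).
Proof.
split=> [|c x y fx fy]; first exact: lp2_0.
by apply: (proj1 (lp2_add _ _)) => //; exact: (proj1 (lp2_scale _ _)).
Qed.

HB.instance Definition _ :=
  GRing.isSubmodClosed.Build _ _ (@lp R 2%:E) lp2_submod_closed.
HB.instance Definition _ := [SubChoice_isSubLmodule of ell2 R by <:].

Definition ell2_norm (x : ell2 R) : R[i] := (l2norm x)%:C%C.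

Lemma ell2_normD x y : ell2_norm (x + y) <= ell2_norm x + ell2_norm y.
Proof.
rewrite /ell2_norm -rmorphD/= lecR.
exact: (proj2 (lp2_add (ell2P x) (ell2P y))).
Qed.

Lemma ell2_normZ (c : R[i]) x : ell2_norm (c *: x) = `|c| * ell2_norm x.
Proof.
by rewrite /ell2_norm (proj2 (lp2_scale c (ell2P x))) rmorphM/=; case: c.
Qed.

Lemma ell2_norm_eq0 x : ell2_norm x = 0 -> x = 0.
Proof.
by move=> /complexI x0; apply: val_inj; apply: l2norm_eq0 => //; exact: ell2P.
Qed.

(* The norm of a normed module over R[i] is R[i]-valued, whence the cast in
   [ell2_norm]. *)
HB.instance Definition _ := Lmodule_isNormed.Build R[i] (ell2 R)
  ell2_normD ell2_normZ ell2_norm_eq0.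

End ell2_structure.

(* Intended for bounded linear T; that [schroedinger v] is one is proved in
   [schroedinger_linear] and [schroedinger_continuous]. *)
Definition resolvent_set (K : numFieldType) (V : normedModType K)
    (T : V -> V) : set K :=
  [set z | exists S : {linear V -> V}, [/\ continuous S,
    (forall x, S (T x - z *: x) = x) & (forall x, T (S x) - z *: S x = x)]].

Definition spectrum (K : numFieldType) (V : normedModType K)
    (T : V -> V) : set K := ~` resolvent_set T.

Section schroedinger.
Context {R : realType}.
Implicit Types (x : ell2 R) (v : int -> R[i]).

Definition ell2_basis (n : int) : ell2 R := Ell2 (lp2_delta n).

Definition shift (k : int) x : ell2 R := Ell2 (proj1 (lp2_shift k (ell2P x))).

Definition laplacian x : ell2 R := shift 1 x + shift (- 1) x.

(* [insubd] returns the pointwise product when it is in l^2, which is always the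
   case for bounded [v] (see [potentialE]), and the default 0 otherwise. *)
Definition potential v x : ell2 R := insubd 0 (fun n => v n * x n).

Definition schroedinger v x : ell2 R := laplacian x + potential v x.

Lemma laplacian_basis n :
  laplacian (ell2_basis n) = ell2_basis (n - 1) + ell2_basis (n + 1).
Proof.
apply: val_inj; apply/funext => m /=.
rewrite -[LHS]/((m + 1 == n)%:R + (m - 1 == n)%:R).
rewrite -[RHS]/((m == n - 1)%:R + (m == n + 1)%:R).
have -> : (m + 1 == n) = (m == n - 1).
  by apply/eqP/eqP => [<-|->]; rewrite ?addrK ?subrK.
have -> // : (m - 1 == n) = (m == n + 1).
by apply/eqP/eqP => [<-|->]; rewrite ?addrK ?subrK.
Qed.

Lemma potentialE p v x n : (0 < p)%E -> v \in lp p ->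
  potential v x n = v n * x n.
Proof.
move=> p0 /(lp_bounded p0)[C C0 vC]; rewrite /potential.
by rewrite -[LHS]/(val (insubd _ _) n) insubdK//;
  exact: (proj1 (lp2_mul C0 vC (ell2P x))).
Qed.

Lemma potential_basis p v n : (0 < p)%E -> v \in lp p ->
  potential v (ell2_basis n) = v n *: ell2_basis n.
Proof.
move=> p0 vp; apply: val_inj; apply/funext => m.
rewrite [LHS](potentialE _ _ p0 vp) -[RHS]/(v n * (m == n)%:R) /=.
by case: eqP => [->|]//; rewrite !mulr0.
Qed.

Lemma laplacian_linear : linear laplacian.
Proof.
move=> c x y; apply: val_inj; apply/funext => m.
rewrite -[LHS]/((c * x (m + 1) + y (m + 1)) + (c * x (m - 1) + y (m - 1))).
rewrite -[RHS]/(c * (x (m + 1) + x (m - 1)) + (y (m + 1) + y (m - 1))).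
by rewrite mulrDr addrACA.
Qed.

Lemma schroedinger_linear p v : (0 < p)%E -> v \in lp p ->
  linear (schroedinger v).
Proof.
move=> p0 vp c x y; rewrite /schroedinger laplacian_linear.
have -> : potential v (c *: x + y) = c *: potential v x + potential v y.
  apply: val_inj; apply/funext => m; rewrite [LHS](potentialE _ _ p0 vp).
  rewrite -[RHS]/(c * potential v x m + potential v y m).
  rewrite !(potentialE _ _ p0 vp) -[(c *: x + y : ell2 R) m]/(c * x m + y m).
  by rewrite mulrDr mulrCA.
by rewrite addrACA [in RHS]scalerDr.
Qed.

Lemma schroedinger_bounded p v : (0 < p)%E -> v \in lp p ->
  exists2 M : R[i], M \is Num.real & forall x, `|schroedinger v x| <= M * `|x|.
Proof.
move=> p0 vp; have [C C0 vC] := lp_bounded p0 vp.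
exists (1 + 1 + C)%:C%C => [|x].
  by rewrite ger0_real// lecR !addr_ge0.
have sh k : `|shift k x| <= `|x|.
  by rewrite lecR; exact: (proj2 (lp2_shift k (ell2P x))).
have po : `|potential v x| <= C%:C%C * `|x|.
  rewrite -rmorphM/= lecR.
  have -> : potential v x = (fun n => v n * x n) :> (int -> R[i]).
    by apply/funext => n; exact: (potentialE _ _ p0 vp).
  exact: (proj2 (lp2_mul C0 vC (ell2P x))).
rewrite rmorphD rmorphD/= !mulrDl rmorph1 !mul1r.
by rewrite (le_trans (ler_normD _ _))// lerD// (le_trans (ler_normD _ _))// lerD.
Qed.

Lemma schroedinger_continuous p v : (0 < p)%E -> v \in lp p ->
  continuous (schroedinger v).
Proof.
move=> p0 vp; have [M Mreal hM] := schroedinger_bounded p0 vp.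
pose T := HB.pack_for {linear ell2 R -> ell2 R} (schroedinger v)
  (GRing.isLinear.Build _ _ _ _ _ (schroedinger_linear p0 vp)).
apply: (@bounded_linear_continuous _ _ _ T).
apply/linear_boundedP; exists M; split=> // r Mr x.
by apply: (le_trans (hM x)); rewrite ler_wpM2r// ltW.
Qed.

End schroedinger.

(* Main.v *)
(** Write [z = k + 1/k] with [0 < |k| <= 1]; when [|k| = 1] the bound is void.
    When [|k| < 1], [H_0 - z] has the Green kernel [k^|m-n| / (k - 1/k)], and
    Hoelder's inequality bounds the row sums of [|G(m,n)| |v_n|] by
    [th = |v|_p |G(0,.)|_q], which is less than 1 exactly when the bound fails.
    Hence [GV] contracts the sup norm, so [H_V - z] is injective, and by the
    Schur test [|V|^(1/2) G |V|^(1/2)] has norm at most [th] on [l^2], so the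
    Neumann series [sum_i (-GV)^i G] converges and [H_V - z] is onto. *)
Require Import Defs.
From HB Require Import structures.
From mathcomp Require Import all_boot all_order all_algebra.
From mathcomp Require Import zify ring lra.
From mathcomp Require Import complex.
From mathcomp Require Import all_classical all_reals all_analysis.
Import Order.TTheory GRing.Theory Num.Theory.
Import numFieldNormedType.Exports.
Import ComplexField.Normc.
Set Implicit Arguments.
Unset Strict Implicit.
Unset Printing Implicit Defensive.
Local Open Scope classical_set_scope.
Local Open Scope ring_scope.

(** * Geometric series in the sequence space *)

Section convergence.
Context {R : realType}.
Implicit Types (t : R) (u : nat -> ell2 R) (z : R[i]).

Lemma ell2_sumE (I : Type) (r : seq I) (u : I -> ell2 R) (m : int) :
  (\sum_(i <- r) u i : ell2 R) m = \sum_(i <- r) u i m.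
Proof.
by rewrite -[LHS]/(val (\sum_(i <- r) u i : ell2 R) m) raddf_sum fct_sumE.
Qed.

Lemma ell2_addE (x y : ell2 R) (m : int) : (x + y : ell2 R) m = x m + y m.
Proof. by []. Qed.

Lemma ell2_subE (x y : ell2 R) (m : int) : (x - y : ell2 R) m = x m - y m.
Proof. by []. Qed.

Lemma sum_geometric_le t N : 0 <= t < 1 -> \sum_(n < N) t ^+ n <= (1 - t)^-1.
Proof.
move=> /andP[t0 t1]; have t'0 : 0 < 1 - t by rewrite subr_gt0.
rewrite -[leRHS]mul1r ler_pdivlMr// mulrC -opprB mulNr -subrX1 opprB.
by rewrite lerBlDr lerDl exprn_ge0.
Qed.

Lemma sqr_normc z : normc z ^+ 2 = complex.Re z ^+ 2 + complex.Im z ^+ 2.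
Proof. by case: z => a b; rewrite /= sqr_sqrtr// addr_ge0// sqr_ge0. Qed.

Lemma normr_Re_le z : `|complex.Re z| <= normc z.
Proof.
rewrite -ler_sqr ?nnegrE ?normr_ge0 ?normc_ge0// real_normK ?num_real//.
by rewrite sqr_normc lerDl sqr_ge0.
Qed.

Lemma normr_Im_le z : `|complex.Im z| <= normc z.
Proof.
rewrite -ler_sqr ?nnegrE ?normr_ge0 ?normc_ge0// real_normK ?num_real//.
by rewrite sqr_normc lerDr sqr_ge0.
Qed.

Lemma l2norm_sum_le (I : Type) (r : seq I) (u : I -> ell2 R) :
  l2norm (\sum_(i <- r) u i : ell2 R) <= \sum_(i <- r) l2norm (u i).
Proof.
elim/big_ind2: _ => [|a x b y xa yb|//].
  have := proj2 (lp2_scale 0 (ell2P (0 : ell2 R))).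
  by rewrite [normc _]normc0 mul0r scale0r => ->.
apply: le_trans (lerD xa yb) => {xa yb}.
exact: (proj2 (lp2_add (ell2P x) (ell2P y))).
Qed.

(** Completeness of l^2 for geometrically decaying terms. Each coordinate series converges
    absolutely, which defines [s] pointwise; the bound on tails then passes to the limit and gives
    both membership in l^2 and the rate. [N = 0] bounds the norm of [s], general [N] identifies its
    coordinates. *)
Lemma ell2_geometric_sum u (C t : R) : 0 <= t < 1 ->
  (forall n, l2norm (u n) <= C * t ^+ n) ->
  exists s : ell2 R, forall N,
    l2norm (s - \sum_(n < N) u n : ell2 R) <= C / (1 - t) * t ^+ N.
Proof.
move=> /[dup] t01 /andP[t0 t1] uC.
have t'0 : 0 < 1 - t by rewrite subr_gt0.
have C0 : 0 <= C.
  have := uC 0; rewrite expr0 mulr1.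
  by apply: le_trans; exact: l2norm_ge0.
have K0 N : 0 <= C / (1 - t) * t ^+ N.
  by rewrite mulr_ge0 ?exprn_ge0// divr_ge0// ltW.
pose S N : ell2 R := \sum_(n < N) u n.
have tail N M : l2norm (S (N + M)%N - S N : ell2 R) <= C / (1 - t) * t ^+ N.
  rewrite /S big_split_ord /= addrAC subrr add0r.
  apply: (le_trans (l2norm_sum_le _ _)).
  apply: (@le_trans _ _ (\sum_(n < M) (C * t ^+ N) * t ^+ n)).
    by apply: ler_sum => n _; rewrite -mulrA -exprD; exact: uC.
  rewrite -mulr_sumr [leRHS]mulrAC ler_wpM2l ?mulr_ge0 ?exprn_ge0//.
  exact: sum_geometric_le.
have summable (f : R[i] -> R) m : (forall z, `|f z| <= normc z) ->
    cvgn (series (fun n => f (u n m))).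
  move=> fle; apply: normed_cvg.
  have := @is_cvg_geometric_series _ C t; rewrite ger0_norm// => /(_ t1).
  apply: series_le_cvg => n; rewrite ?normr_ge0//.
    by rewrite /geometric/= mulr_ge0 ?exprn_ge0.
  apply: (le_trans (fle _)); apply: le_trans (uC n).
  exact: (l2norm_coord m (ell2P (u n))).
pose s0 m : R[i] := Complex (limn (series (fun n => complex.Re (u n m))))
                            (limn (series (fun n => complex.Im (u n m)))).
have SRe m N : complex.Re (S N m) = series (fun n => complex.Re (u n m)) N.
  by rewrite /S ell2_sumE (raddf_sum (@complex.Re R)) /series /= big_mkord.
have SIm m N : complex.Im (S N m) = series (fun n => complex.Im (u n m)) N.
  by rewrite /S ell2_sumE (raddf_sum (@complex.Im R)) /series /= big_mkord.
have cS (z : R[i]) m :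
    normc (S N m - z) ^+ 2 @[N --> \oo] --> normc (s0 m - z) ^+ 2.
  under eq_fun do rewrite sqr_normc !raddfB /= SRe SIm.
  rewrite sqr_normc !raddfB /=.
  by apply: cvgD; rewrite !expr2; apply: cvgM; apply: cvgB;
    [exact: summable normr_Re_le|exact: cvg_cst|exact: summable normr_Re_le|
     exact: cvg_cst|exact: summable normr_Im_le|exact: cvg_cst|
     exact: summable normr_Im_le|exact: cvg_cst].
have bound N : (s0 - S N : int -> R[i]) \in lp 2%:E /\
    l2norm (s0 - S N : int -> R[i]) <= C / (1 - t) * t ^+ N.
  apply: lp2P => // r ur.
  (* On finitely many coordinates the limit is taken termwise, and [tail] bounds the sums uniformly
     in [M >= N]. *)
  have : \sum_(m <- r) normc (S M m - S N m) ^+ 2 @[M --> \oo] -->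
         \sum_(m <- r) normc (s0 m - S N m) ^+ 2.
    elim: {ur}r => [|m r IH].
      by rewrite big_nil; under eq_fun do rewrite big_nil; exact: cvg_cst.
    rewrite big_cons; under eq_fun do rewrite big_cons.
    by apply: cvgD => //; exact: cS.
  move=> /cvgr_to_le; apply; exists N => // M /= NM.
  rewrite -(subnKC NM); set M' := (M - N)%N.
  apply: le_trans (_ : l2norm (S (N + M')%N - S N : ell2 R) ^+ 2 <= _).
    exact: (l2norm_sum (ell2P (S (N + M')%N - S N)) ur).
  by rewrite lerXn2r ?nnegrE ?l2norm_ge0.
have s0P : s0 \in lp 2%:E.
  by have [] := bound 0; rewrite /S big_ord0 [(_ - _)]subr0.
by exists (Ell2 s0P) => N; exact: (proj2 (bound N)).
Qed.

End convergence.

(** * Inequalities up to a geometrically decaying error *)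

Section geometric.
Context {R : realType}.

(** Serves to remove truncation errors: those of the Green kernel decay like [normc k ^+ N], those
    of the Neumann series like [th ^+ N]. *)
Lemma le_of_geometric (t K x y : R) : 0 <= t < 1 ->
  (forall N, x <= y + K * t ^+ N) -> x <= y.
Proof.
move=> /andP[t0 t1] h.
have c : y + K * t ^+ N @[N --> \oo] --> y.
  rewrite -[X in _ --> X]addr0; apply: cvgD; first exact: cvg_cst.
  by have := @cvg_geometric R K t; rewrite ger0_norm//; exact.
by apply: (cvgr_to_ge c); exists 0 => // N _ /=; exact: h.
Qed.

Lemma normcX (z : R[i]) n : normc (z ^+ n) = normc z ^+ n.
Proof. by elim: n => [|n IH]; [exact: normc1|rewrite !exprS normcM IH]. Qed.

Lemma le_normcB (x y : R[i]) : normc (x - y) <= normc x + normc y.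
Proof. by rewrite -[normc y]normcN; exact: le_normcD. Qed.

Lemma le_normc_sum (I : Type) (r : seq I) (F : I -> R[i]) :
  normc (\sum_(i <- r) F i) <= \sum_(i <- r) normc (F i).
Proof.
elim: r => [|i r IH]; first by rewrite !big_nil [normc _]normc0.
by rewrite !big_cons; apply: le_trans (le_normcD _ _) _; rewrite lerD2l.
Qed.

Lemma eq_of_geometric (t K : R) (x y : R[i]) : 0 <= t < 1 ->
  (forall N, normc (x - y) <= K * t ^+ N) -> x = y.
Proof.
move=> t01 h; apply/eqP; rewrite -subr_eq0; apply/eqP/eq0_normc/le_anti.
rewrite normc_ge0 andbT; apply: (@le_of_geometric t K) => // N.
by rewrite add0r.
Qed.

End geometric.

(** * The Green kernel of the free Laplacian *)

(* [zrange N] lists the integers from [-N] to [N-1]. *)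
Fixpoint zrange N : seq int :=
  if N is n.+1 then Posz n :: Negz n :: zrange n else [::].

Lemma zrangeS N : zrange N.+1 = [:: Posz N, Negz N & zrange N].
Proof. by []. Qed.

Lemma zrange_uniq N : uniq (zrange N).
Proof.
have mem n j : j \in zrange n ->
    match j with Posz i => (i < n)%N | Negz i => (i < n)%N end.
  elim: n => //= n IH; rewrite !inE => /or3P[/eqP->|/eqP->|/IH] //.
  by case: j {IH} => i /ltnW.
elim: N => //= n ->; rewrite andbT inE /=.
by apply/andP; split; apply/negP => /mem; rewrite ltnn.
Qed.

Section green.
Context {R : realType} (k : R[i]) (k0 : k != 0) (k1 : normc k < 1).
Implicit Types (f : int -> R[i]) (M : R).

(** The expression of H_0 - (k + 1/k) on arbitrary sequences, so that it also applies to truncations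
    outside [ell2]. *)
Definition shifted_laplacian f (m : int) : R[i] :=
  f (m + 1) + f (m - 1) - (k + k^-1) * f m.

(** Convolution with the Green kernel of H_0 - (k + 1/k), cut off to displacements [j] in [-N, N-1]:
    a finite sum, defined for every [f]. *)
Definition green N f (m : int) : R[i] :=
  (k - k^-1)^-1 * \sum_(j <- zrange N) k ^+ `|j| * f (m + j).

Let k01 : 0 <= normc k < 1. Proof. by rewrite k1 normc_ge0. Qed.

(** Otherwise k^2 = 1, hence |k| = 1. *)
Lemma subkVk_neq0 : k - k^-1 != 0.
Proof.
rewrite subr_eq0; apply: contraTneq k1 => kV; rewrite -leNgt.
rewrite -(@ler_pXn2r _ 2) ?nnegrE ?normc_ge0// expr1n -normcX expr2.
by rewrite {1}kV mulVf// [normc _]normc1.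
Qed.

(** The powers k^|j| solve the homogeneous recurrence away from [j = 0], so apart from [f m] only
    the terms at the two cut ends survive. At [N = 0] these terms cancel [f m] exactly. *)
Lemma shifted_laplacian_green N f m :
  shifted_laplacian (green N f) m = f m - (k - k^-1)^-1 *
    (k ^+ N * (f (m + Posz N - 1) - k^-1 * f (m + Posz N)
       + k * f (m - Posz N) - f (m - Posz N - 1))).
Proof.
rewrite /shifted_laplacian /green; have := subkVk_neq0; set c := k - k^-1 => c0.
elim: N => [|N IH].
  rewrite !big_nil !mulr0 !addr0 !subr0 expr0 mul1r.
  have -> : f (m - 1) - k^-1 * f m + k * f m - f (m - 1) = c * f m.
    by rewrite /c; ring.
  by rewrite mulKf// subrr.
rewrite zrangeS !big_cons !NegzE !mulrDr.
move: IH; set A := _ * bigop _ _ _; set B := _ * bigop _ _ _.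
set C := (k + k^-1) * _ => IH.
have -> : A = f m - c^-1 * (k ^+ N * (f (m + Posz N - 1) - k^-1 * f (m + Posz N)
       + k * f (m - Posz N) - f (m - Posz N - 1))) - B + C.
  by rewrite -IH; ring.
rewrite !abszN !absz_nat exprS.
have -> : m + 1 + Posz N = m + Posz N.+1 by lia.
have -> : m - 1 + Posz N = m + Posz N - 1 by lia.
have -> : m + 1 - Posz N.+1 = m - Posz N by lia.
have -> : m - 1 - Posz N.+1 = m - Posz N.+1 - 1 by lia.
have -> : m + Posz N.+1 - 1 = m + Posz N by lia.
have -> : m - Posz N - 1 = m - Posz N.+1 by lia.
by field; rewrite k0 c0.
Qed.

(** Both are finite combinations of translations. Hence [green] is an approximate left inverse as
    well as a right one. *)
Lemma green_shifted_laplacian N f m :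
  green N (shifted_laplacian f) m = shifted_laplacian (green N f) m.
Proof.
rewrite /shifted_laplacian /green.
rewrite [X in _ = _ - X]mulrCA -mulrDr -mulrBr; congr (_ * _).
rewrite mulr_sumr -big_split /= -sumrB; apply: eq_bigr => j _.
by rewrite [m + j + 1]addrAC [m + j - 1]addrAC; ring.
Qed.

Lemma shifted_laplacianB f g m :
  shifted_laplacian (f - g) m = shifted_laplacian f m - shifted_laplacian g m.
Proof.
rewrite /shifted_laplacian.
have fgE n : (f - g) n = f n - g n by [].
by rewrite !fgE; ring.
Qed.

Lemma le_normc_shifted_laplacian f M : (forall n, normc (f n) <= M) ->
  forall m, normc (shifted_laplacian f m) <= (1 + 1 + normc (k + k^-1)) * M.
Proof.
move=> fM m; rewrite !mulrDl mul1r; apply: le_trans (le_normcB _ _) _.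
apply: lerD; first by apply: le_trans (le_normcD _ _) _; apply: lerD.
by rewrite normcM ler_wpM2l ?normc_ge0.
Qed.

(** The bracketed constant adds the moduli of the coefficients of the four end terms. *)
Lemma green_error f M : (forall n, normc (f n) <= M) -> forall N m,
  normc (shifted_laplacian (green N f) m - f m) <=
    (normc (k - k^-1))^-1 * (1 + (normc k)^-1 + normc k + 1) * M
    * normc k ^+ N.
Proof.
move=> fM N m; rewrite shifted_laplacian_green addrAC subrr add0r normcN.
rewrite normcM normcV -!mulrA ler_wpM2l ?invr_ge0 ?normc_ge0//.
rewrite normcM normcX mulrA [leRHS]mulrC ler_wpM2l ?exprn_ge0 ?normc_ge0//.
rewrite !mulrDl !mul1r; apply: le_trans (le_normcB _ _) _; apply: lerD => //.
apply: le_trans (le_normcD _ _) _; apply: lerD; last first.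
  by rewrite normcM ler_wpM2l ?normc_ge0.
apply: le_trans (le_normcB _ _) _; apply: lerD => //.
by rewrite normcM normcV ler_wpM2l ?invr_ge0 ?normc_ge0.
Qed.

Lemma l2norm_shift_le (j : int) (y : ell2 R) :
  l2norm (Defs.shift j y) <= l2norm y.
Proof. exact: (proj2 (lp2_shift j (ell2P y))). Qed.

(** Translations do not increase the l^2 norm, so the kernel sums to a bounded operator; [E] is the
    sum of the resulting geometric series. [G] is tied to the truncations by an explicit error
    instead of an infinite sum. *)
Lemma green_operator : exists (G : ell2 R -> ell2 R) (E : R), 0 <= E /\
  forall y, l2norm (G y) <= E * l2norm y /\
  forall N m, normc (G y m - green N y m) <= E * l2norm y * normc k ^+ N.
Proof.
pose E := (normc (k - k^-1))^-1 * (1 + 1) / (1 - normc k).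
have E0 : 0 <= E by rewrite !mulr_ge0 ?invr_ge0 ?normc_ge0// subr_ge0 ltW.
suff /choice[G GP] : forall y : ell2 R, exists x : ell2 R,
    l2norm x <= E * l2norm y /\
    forall N m, normc (x m - green N y m) <= E * l2norm y * normc k ^+ N.
  by exists G, E.
move=> y; pose c := k - k^-1.
(* The displacements [n] and [-(n+1)], which [zrange] adds together; both weights are at most
   |k|^n. *)
pose u n : ell2 R :=
  c^-1 *: (k ^+ n *: Defs.shift (Posz n) y
           + k ^+ n.+1 *: Defs.shift (Negz n) y).
have uE n : l2norm (u n) <= (normc c)^-1 * (1 + 1) * l2norm y * normc k ^+ n.
  have e d (x : ell2 R) : l2norm (d *: x : ell2 R) = normc d * l2norm x.
    exact: (proj2 (lp2_scale d (ell2P x))).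
  rewrite e normcV -!mulrA ler_wpM2l ?invr_ge0 ?normc_ge0// mulrA.
  apply: le_trans (proj2 (lp2_add (ell2P _) (ell2P _))) _.
  rewrite !e !normcX [leRHS]mulrC mulrDl mul1r mulrDr.
  apply: lerD.
    by rewrite ler_wpM2l ?exprn_ge0 ?normc_ge0 ?l2norm_shift_le.
  apply: ler_pM; rewrite ?exprn_ge0 ?normc_ge0 ?l2norm_ge0 ?l2norm_shift_le//.
  by rewrite exprS ler_piMl ?exprn_ge0 ?normc_ge0 ?(ltW k1).
have [s sP] := ell2_geometric_sum k01 uE.
have Er : E * l2norm y = (normc c)^-1 * (1 + 1) * l2norm y / (1 - normc k).
  by rewrite /E -/c mulrAC.
exists s; split=> [|N m].
  by have := sP 0; rewrite big_ord0 subr0 expr0 mulr1 Er.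
rewrite Er; apply: le_trans (sP N).
have := l2norm_coord m (ell2P (s - \sum_(n < N) u n : ell2 R)).
apply: le_trans; rewrite ell2_subE ell2_sumE /green -/c.
suff -> : \sum_(n < N) u n m =
  c^-1 * \sum_(j <- zrange N) k ^+ `|j| * y (m + j) by [].
elim: N => [|N IH]; first by rewrite big_ord0 big_nil mulr0.
have uNE : u N m =
  c^-1 * (k ^+ N * y (m + Posz N) + k ^+ N.+1 * y (m + Negz N)) by [].
rewrite big_ord_recr [ell2_fun (u ord_max) m]uNE {}IH zrangeS !big_cons.
by rewrite [LHS]addrC -mulrDr -addrA absz_nat.
Qed.

(** Split at [green N y]: [shifted_laplacian] is bounded in the sup norm, which handles
    [x - green N y], and [green_error] handles the rest. *)
Lemma shifted_laplacian_inv (x y : ell2 R) K :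
  (forall N m, normc (x m - green N y m) <= K * normc k ^+ N) ->
  forall m, shifted_laplacian x m = y m.
Proof.
move=> xy m.
pose D := (normc (k - k^-1))^-1 * (1 + (normc k)^-1 + normc k + 1) * l2norm y.
apply: (@eq_of_geometric _ (normc k)
  ((1 + 1 + normc (k + k^-1)) * K + D)) => // N.
have -> : shifted_laplacian x m - y m =
    shifted_laplacian (ell2_fun x - green N y) m
    + (shifted_laplacian (green N y) m - y m).
  by rewrite shifted_laplacianB; ring.
rewrite mulrDl; apply: le_trans (le_normcD _ _) _; apply: lerD; last first.
  by apply: green_error => n; exact: l2norm_coord (ell2P y).
by rewrite -mulrA; apply: le_normc_shifted_laplacian => n; exact: xy.
Qed.

End green.

(** * Schur test *)

Section schur.
Context {R : realType}.

(** Cauchy-Schwarz with weights [w], by induction on the list. *)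
Lemma sqr_sum_le (I : Type) (r : seq I) (w x : I -> R) :
  (forall i, 0 <= w i) ->
  (\sum_(i <- r) w i * x i) ^+ 2 <=
    (\sum_(i <- r) w i) * \sum_(i <- r) w i * x i ^+ 2.
Proof.
move=> w0; elim: r => [|i r]; first by rewrite !big_nil mul0r expr0n.
rewrite !big_cons; have := w0 i.
have : 0 <= \sum_(j <- r) w j by apply: sumr_ge0.
have : 0 <= \sum_(j <- r) w j * x j ^+ 2.
  by apply: sumr_ge0 => j _; rewrite mulr_ge0 ?sqr_ge0.
move: (\sum_(j <- r) w j) (\sum_(j <- r) w j * x j ^+ 2) => W Q.
move: (\sum_(j <- r) w j * x j) (w i) (x i) => S a b Q0 W0 a0 SWQ.
(* Only the cross term is at stake. If W = 0 then S = 0; otherwise W times the difference is (W b -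
   S)^2 + (W Q - S^2). *)
suff h : S * b *+ 2 <= W * b ^+ 2 + Q.
  rewrite -subr_ge0.
  have -> : (a + W) * (a * b ^+ 2 + Q) - (a * b + S) ^+ 2 =
    a * (W * b ^+ 2 + Q - S * b *+ 2) + (W * Q - S ^+ 2) by ring.
  by rewrite addr_ge0 ?subr_ge0// mulr_ge0// subr_ge0.
have [Wz|Wz] := eqVneq W 0.
  move: SWQ; rewrite Wz !mul0r add0r exprn_even_le0//= => /eqP->.
  by rewrite mul0r mul0rn.
have {}W0 : 0 < W by rewrite lt_def Wz.
rewrite -subr_ge0 -(@pmulr_rge0 _ W)//.
have -> : W * (W * b ^+ 2 + Q - S * b *+ 2) =
  (W * b - S) ^+ 2 + (W * Q - S ^+ 2) by ring.
by rewrite addr_ge0 ?sqr_ge0// subr_ge0.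
Qed.

Lemma ler_sum_uniq (I : eqType) (s t : seq I) (F : I -> R) :
  uniq s -> uniq t -> {subset s <= t} -> (forall i, 0 <= F i) ->
  \sum_(i <- s) F i <= \sum_(i <- t) F i.
Proof.
move=> us ut st F0; rewrite [leRHS](bigID (mem s)) /= -[leRHS]addrC.
rewrite (perm_big [seq i <- t | i \in s]) ?big_filter ?lerDr ?sumr_ge0//.
apply: uniq_perm => // [|i]; first exact: filter_uniq.
by rewrite mem_filter; apply/idP/andP => [si|[]//]; split=> //; exact: st.
Qed.

Context (k : R[i]) (k0 : k != 0) (k1 : normc k < 1).
Context (v : int -> R[i]) (th : R).
(** An arbitrary injective [phi] covers both the rows, [phi j = m + j], and the columns,
    [phi j = n - j], of the kernel. *)
Context (green_row_le : forall N (phi : int -> int), injective phi ->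
  (normc (k - k^-1))^-1 *
    (\sum_(j <- zrange N) normc k ^+ `|j| * normc (v (phi j))) <= th).

Let c_ge0 : 0 <= (normc (k - k^-1))^-1.
Proof. by rewrite invr_ge0 normc_ge0. Qed.

Let th_ge0 : 0 <= th.
Proof. by have := @green_row_le 0 id (@inj_id _); rewrite big_nil mulr0. Qed.

Lemma normc_green_potential N (f : int -> R[i]) m :
  normc (green k N (fun n => v n * f n) m) <=
    (normc (k - k^-1))^-1 * \sum_(j <- zrange N)
      normc k ^+ `|j| * normc (v (m + j)) * normc (f (m + j)).
Proof.
rewrite /green normcM normcV ler_wpM2l//; apply: le_trans (le_normc_sum _ _) _.
by apply: ler_sum => j _; rewrite !normcM normcX mulrA.
Qed.

Lemma green_potential_sup N (f : int -> R[i]) (M : R) m :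
  (forall n, normc (f n) <= M) ->
  normc (green k N (fun n => v n * f n) m) <= th * M.
Proof.
move=> fM; have M0 : 0 <= M by apply: le_trans (fM 0); exact: normc_ge0.
apply: le_trans (normc_green_potential _ _ _) _.
apply: le_trans (_ : (normc (k - k^-1))^-1 *
    (\sum_(j <- zrange N) normc k ^+ `|j| * normc (v (m + j))) * M <= _).
  rewrite -mulrA ler_wpM2l// mulr_suml.
  apply: ler_sum => j _; rewrite ler_wpM2l// mulr_ge0 ?normc_ge0//.
  by rewrite exprn_ge0 ?normc_ge0.
by rewrite ler_wpM2r//; apply: green_row_le; exact: addrI.
Qed.

(* This bounds |V|^(1/2) G |V|^(1/2) on l^2 by [th]: Schur test with the weight
   |V|^(1/2). *)
Lemma green_potential_weighted N (f : int -> R[i]) (B : R) :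
  (forall s, uniq s -> \sum_(m <- s) normc (v m) * normc (f m) ^+ 2 <= B) ->
  forall s, uniq s ->
  \sum_(m <- s) normc (v m) * normc (green k N (fun n => v n * f n) m) ^+ 2
    <= th ^+ 2 * B.
Proof.
move=> fB s us; pose h n := normc (v n) * normc (f n) ^+ 2.
have row_le := green_row_le; have c0 := c_ge0.
set c := (normc (k - k^-1))^-1 in row_le c0 *.
have h0 n : 0 <= h n by rewrite mulr_ge0 ?sqr_ge0 ?normc_ge0.
pose g (j : int) := normc k ^+ `|j|.
have g0 j : 0 <= g j by rewrite exprn_ge0 ?normc_ge0.
(* Cauchy-Schwarz with weights [g j * normc (v (m + j))], whose sum is a row sum: this yields the
   first factor [th]. *)
have sq m : normc (green k N (fun n => v n * f n) m) ^+ 2 <=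
    th * (c * \sum_(j <- zrange N) g j * h (m + j)).
  apply: (@le_trans _ _ ((c * \sum_(j <- zrange N)
      g j * normc (v (m + j)) * normc (f (m + j))) ^+ 2)).
    rewrite lerXn2r ?nnegrE ?normc_ge0//; last exact: normc_green_potential.
    by rewrite mulr_ge0// sumr_ge0// => j _; rewrite !mulr_ge0 ?g0 ?normc_ge0.
  rewrite exprMn; apply: (@le_trans _ _ (c ^+ 2 * ((\sum_(j <- zrange N)
      g j * normc (v (m + j))) * \sum_(j <- zrange N) g j * h (m + j)))).
    rewrite ler_wpM2l ?sqr_ge0//.
    under [X in _ <= _ * X]eq_bigr do rewrite /h mulrA.
    by apply: sqr_sum_le => j; rewrite mulr_ge0 ?g0 ?normc_ge0.
  rewrite expr2 mulrACA ler_wpM2r//; last by apply: row_le; exact: addrI.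
  by rewrite mulr_ge0// sumr_ge0// => j _; rewrite mulr_ge0.
(* A finite set containing every [m + j], so that after substituting [n = m + j] the range of [n] no
   longer depends on [j]. *)
pose t := undup [seq m + j | m <- s, j <- zrange N].
have row j : j \in zrange N -> \sum_(m <- s) normc (v m) * h (m + j) <=
    \sum_(n <- t) normc (v (n - j)) * h n.
  move=> jN; pose F n := normc (v (n - j)) * h n.
  rewrite (eq_bigr (fun m => F (m + j))) => [|m _]; last by rewrite /F addrK.
  rewrite -(big_map (fun m => m + j) predT F); apply: ler_sum_uniq.
  - by rewrite map_inj_uniq//; exact: addIr.
  - exact: undup_uniq.
  - move=> _ /mapP[m ms ->]; rewrite mem_undup.
    by apply/allpairsP; exists (m, j).
  - by move=> n; rewrite mulr_ge0 ?normc_ge0.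
apply: (@le_trans _ _ (th * (c * \sum_(j <- zrange N)
    g j * \sum_(m <- s) normc (v m) * h (m + j)))).
  under [X in _ <= _ * (_ * X)]eq_bigr do rewrite mulr_sumr.
  rewrite exchange_big !mulr_sumr /=; apply: ler_sum => m _.
  apply: (le_trans (ler_wpM2l (normc_ge0 _) (sq m))).
  rewrite mulrCA [_ * (c * _)]mulrCA ler_wpM2l// ler_wpM2l// mulr_sumr.
  by apply: ler_sum => j _; rewrite mulrCA.
apply: (@le_trans _ _ (th * (th * \sum_(n <- t) h n))); last first.
  by rewrite mulrA -expr2 ler_wpM2l ?sqr_ge0//; apply: fB; exact: undup_uniq.
rewrite ler_wpM2l//.
apply: (@le_trans _ _ (c * \sum_(j <- zrange N)
    g j * \sum_(n <- t) normc (v (n - j)) * h n)).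
  rewrite ler_wpM2l// big_seq [leRHS]big_seq; apply: ler_sum => j jN.
  by rewrite ler_wpM2l// row.
under eq_bigr do rewrite mulr_sumr.
rewrite exchange_big /= !mulr_sumr; apply: ler_sum => n _.
under eq_bigr do rewrite mulrA.
rewrite -mulr_suml mulrA ler_wpM2r//.
(* The column sum yields the second factor [th]. *)
by apply: (@row_le N (fun j => n - j)) => i j /addrI/oppr_inj.
Qed.

End schur.

(** * Invertibility of the shifted operator *)

Section resolvent.
Context {R : realType}.

(** Injectivity makes the chosen preimages linear in [y] and a left inverse; the bound makes them
    continuous. *)
Lemma resolvent_set_bounded_inverse (V : normedModType R[i])
    (T : {linear V -> V}) (z : R[i]) (K : R[i]) :
  K \is Num.real ->
  (forall x, T x - z *: x = 0 -> x = 0) ->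
  (forall y, exists x, T x - z *: x = y /\ `|x| <= K * `|y|) ->
  resolvent_set T z.
Proof.
move=> Kreal inj /choice[S SP].
have uniqS x y : T x - z *: x = T y - z *: y -> x = y.
  move=> /eqP; rewrite -subr_eq0 => /eqP h; apply/eqP; rewrite -subr_eq0.
  apply/eqP/inj; rewrite raddfB scalerBr -[RHS]h !opprD !opprK.
  by rewrite addrACA.
have linS : linear S.
  move=> c x y; apply: uniqS; rewrite (proj1 (SP _)).
  rewrite linearP scalerDr opprD addrACA (proj1 (SP y)); congr (_ + _).
  by rewrite scalerA mulrC -scalerA -scalerBr (proj1 (SP x)).
pose L := HB.pack_for {linear V -> V} S (GRing.isLinear.Build _ _ _ _ _ linS).
exists L; split=> [|x|x].
- apply: (@bounded_linear_continuous _ _ _ L); apply/linear_boundedP.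
  exists K; split=> // r Kr x; apply: (le_trans (proj2 (SP x))).
  by rewrite ler_wpM2r// ltW.
- by apply: uniqS; exact: (proj1 (SP _)).
- exact: (proj1 (SP _)).
Qed.

(** Used with [a] the truncated value and [b] its limit. The error coefficient involves [b] only,
    since [a] varies with the truncation. *)
Lemma sqr_perturbation (a b K t : R) : 0 <= a -> 0 <= b -> 0 <= K ->
  0 <= t <= 1 -> b <= a + K * t -> a <= b + K * t ->
  b ^+ 2 <= a ^+ 2 + ((b + K) * K *+ 2 + K ^+ 2) * t.
Proof.
move=> a0 b0 K0 /andP[t0 t1] ba ab.
have Kt0 : 0 <= K * t by rewrite mulr_ge0.
have KtK : K * t <= K by rewrite ler_piMr.
apply: (@le_trans _ _ ((a + K * t) ^+ 2)).
  by rewrite lerXn2r ?nnegrE// (le_trans b0).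
have h1 : a * (K * t) <= (b + K) * (K * t).
  by rewrite ler_wpM2r// (le_trans ab)// lerD2l.
have h2 : (K * t) * (K * t) <= K * (K * t) by rewrite ler_wpM2r.
nra.
Qed.

Context (p : \bar R) (v : int -> R[i]) (p0 : (0 < p)%E) (v_lp : v \in lp p).
Context (k : R[i]) (k0 : k != 0) (k1 : normc k < 1).
Context (th : R) (th0 : 0 < th) (th1 : th < 1).
Context (green_row_le : forall N (phi : int -> int), injective phi ->
  (normc (k - k^-1))^-1 *
    (\sum_(j <- zrange N) normc k ^+ `|j| * normc (v (phi j))) <= th).

Let k01 : 0 <= normc k < 1. Proof. by rewrite k1 normc_ge0. Qed.
Let th01 : 0 <= th < 1. Proof. by rewrite th1 ltW. Qed.

Lemma schroedingerE x m : (schroedinger v x - (k + k^-1) *: x : ell2 R) m =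
  shifted_laplacian k x m + v m * x m.
Proof.
have -> : (schroedinger v x - (k + k^-1) *: x : ell2 R) m =
  x (m + 1) + x (m - 1) + potential v x m - (k + k^-1) * x m by [].
by rewrite (potentialE _ _ p0 v_lp) /shifted_laplacian addrAC.
Qed.

(** A solution satisfies x = -GVx up to truncation error, so its sup norm shrinks by [th] at each
    iteration. *)
Lemma schroedinger_shift_inj x :
  schroedinger v x - (k + k^-1) *: x = 0 -> x = 0.
Proof.
move=> x0; pose f n : R[i] := - (v n * x n).
have Lx : shifted_laplacian k x = f.
  apply/funext => m; apply/eqP; rewrite -subr_eq0 opprK -schroedingerE x0.
  by [].
have iter i n : normc (x n) <= l2norm x * th ^+ i.
  elim: i n => [|i IH] n; first by rewrite mulr1; exact: l2norm_coord (ell2P x).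
  apply: (le_of_geometric k01) => N.
  have -> : x n = green k N (shifted_laplacian k x) n -
      (shifted_laplacian k (green k N x) n - x n).
    by rewrite green_shifted_laplacian subKr.
  apply: le_trans (le_normcB _ _) _; apply: lerD; last first.
    by apply: green_error => // m; exact: l2norm_coord (ell2P x).
  have -> : green k N (shifted_laplacian k x) n =
      - green k N (fun m => v m * x m) n.
    rewrite Lx /green -mulrN -sumrN; congr (_ * _).
    by apply: eq_bigr => j _; rewrite /f mulrN.
  rewrite normcN exprSr mulrA [leRHS]mulrC.
  exact: green_potential_sup.
apply: val_inj; apply/funext => n; apply: (eq_of_geometric th01) => N.
by rewrite subr0; exact: iter.
Qed.

(** The terms (-GV)^i G y decay first in the seminorm weighted by |V|; multiplication by V carries
    this decay back to l^2, where G is bounded. *)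
Lemma schroedinger_shift_surj : exists K : R, forall y : ell2 R,
  exists x, schroedinger v x - (k + k^-1) *: x = y /\ l2norm x <= K * l2norm y.
Proof.
have [C C0 vC] := lp_bounded p0 v_lp.
have [G [E [E0 GP]]] := green_operator k1.
have LG y m : shifted_laplacian k (G y) m = y m.
  by apply: (shifted_laplacian_inv k0 k1) => N n; exact: (proj2 (GP y)).
(* The summand 1 serves [i = 0]. Term [i + 1] inherits only the decay [th ^+ i] of its predecessor,
   whence the division by [th]. *)
pose D := E * (1 + C * E / th).
exists (D / (1 - th)) => y.
pose x := fix x i : ell2 R :=
  if i is j.+1 then - G (potential v (x j)) else G y.
pose w i : ell2 R := potential v (x i).
have wE i : ell2_fun (w i) = fun n => v n * x i n.
  by apply/funext => n; exact: (potentialE _ _ p0 v_lp).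
have weighted i s : uniq s -> \sum_(m <- s) normc (v m) * normc (x i m) ^+ 2 <=
    C * (th ^+ i * (E * l2norm y)) ^+ 2.
  elim: i s => [|i IH] s us.
    rewrite expr0 mul1r.
    apply: (@le_trans _ _ (\sum_(m <- s) C * normc (x 0%N m) ^+ 2)).
      by apply: ler_sum => m _; rewrite ler_wpM2r ?sqr_ge0.
    rewrite -mulr_sumr ler_wpM2l//.
    apply: (le_trans (l2norm_sum (ell2P (x 0%N)) us)).
    rewrite lerXn2r ?nnegrE ?l2norm_ge0// ?mulr_ge0 ?l2norm_ge0//.
    exact: (proj1 (GP y)).
  have -> : C * (th ^+ i.+1 * (E * l2norm y)) ^+ 2 =
      th ^+ 2 * (C * (th ^+ i * (E * l2norm y)) ^+ 2).
    by rewrite [th ^+ i.+1]exprS; ring.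
  have gs N :=
    @green_potential_weighted _ k v th green_row_le N (x i) _ IH s us.
  have xS m : normc (x i.+1 m) = normc (G (w i) m) by exact: normcN.
  under eq_bigr do rewrite xS.
  pose K := E * l2norm (w i).
  have K0 : 0 <= K by rewrite mulr_ge0 ?l2norm_ge0.
  (* The set [s] stays fixed while [N] grows, so the pointwise errors may be summed over it. *)
  apply: (@le_of_geometric _ (normc k) (\sum_(m <- s) normc (v m) *
    ((normc (G (w i) m) + K) * K *+ 2 + K ^+ 2))) => // N.
  apply: (le_trans _ (lerD (gs N) (lexx _))).
  rewrite mulr_suml -big_split /=; apply: ler_sum => m _.
  rewrite -mulrA -mulrDr ler_wpM2l ?normc_ge0//.
  have := proj2 (GP (w i)) N m; rewrite -/K wE.
  set g := green k N _ m; set t := normc k ^+ N => gt.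
  have t01 : 0 <= t <= 1.
    rewrite /t exprn_ge0 ?normc_ge0//=.
    by apply: exprn_ile1; [exact: normc_ge0|exact: ltW].
  have h1 : normc (G (w i) m) <= normc g + K * t.
    rewrite -[X in normc X](subrK g) [leRHS]addrC.
    by apply: le_trans (le_normcD _ _) _; rewrite lerD2r.
  have h2 : normc g <= normc (G (w i) m) + K * t.
    rewrite -[X in normc X](subrK (G (w i) m)) [leRHS]addrC.
    apply: le_trans (le_normcD _ _) _; rewrite lerD2r.
    by rewrite -normcN opprB.
  have := normc_ge0 (G (w i) m); have := normc_ge0 g.
  move: (normc g) (normc (G (w i) m)) h1 h2 => a b h1 h2 a0 b0.
  exact: sqr_perturbation.
(* From |v x|^2 <= C |v| |x|^2. *)
have l2w i : l2norm (w i) <= C * (th ^+ i * (E * l2norm y)).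
  apply: (proj2 (lp2P _ _)) => [|s us].
    by rewrite !mulr_ge0 ?exprn_ge0 ?l2norm_ge0// ltW.
  rewrite wE; apply: (@le_trans _ _
      (C * \sum_(m <- s) normc (v m) * normc (x i m) ^+ 2)).
    rewrite mulr_sumr; apply: ler_sum => m _.
    rewrite normcM exprMn expr2 -mulrA ler_wpM2r//.
    by rewrite mulr_ge0 ?sqr_ge0 ?normc_ge0.
  by rewrite exprMn [C ^+ 2]expr2 -mulrA ler_wpM2l// weighted.
have xD i : l2norm (x i) <= D * l2norm y * th ^+ i.
  case: i => [|i].
    rewrite mulr1; apply: (le_trans (proj1 (GP y))).
    rewrite ler_wpM2r ?l2norm_ge0// ler_peMr// lerDl.
    by rewrite divr_ge0 ?mulr_ge0// ltW.
  have -> : l2norm (x i.+1) = l2norm (G (w i)).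
    have := proj2 (lp2_scale (-1) (ell2P (G (w i)))).
    by rewrite scaleN1r normcN [normc _]normc1 mul1r.
  apply: (le_trans (proj1 (GP (w i)))).
  apply: (le_trans (ler_wpM2l E0 (l2w i))).
  have -> : D * l2norm y * th ^+ i.+1 = E * l2norm y * th ^+ i.+1 +
      E * (C * (th ^+ i * (E * l2norm y))).
    by rewrite /D exprS; field; rewrite gt_eqF.
  by rewrite lerDr !mulr_ge0 ?exprn_ge0 ?l2norm_ge0// ltW.
have [X XP] := ell2_geometric_sum th01 xD.
exists X; split; last first.
  have := XP 0%N; rewrite big_ord0 subr0 expr0 mulr1.
  by rewrite mulrAC.
apply: val_inj; apply/funext => m.
pose S N : ell2 R := \sum_(i < N) x i.
rewrite -[LHS]/((schroedinger v X - (k + k^-1) *: X : ell2 R) m) schroedingerE.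
(* Telescoping: one more term on the left, since H_0 - z sends each new term to -V times the
   previous one. *)
have SE N : shifted_laplacian k (S N.+1) m = y m - v m * S N m.
  have SS j : S j.+1 = S j + x j by rewrite /S big_ord_recr.
  elim: N => [|N IH].
    rewrite SS /S big_ord0 add0r LG.
    by rewrite -[ell2_fun 0 m]/(0 : R[i]) mulr0 subr0.
  have LD : shifted_laplacian k (S N.+2) m =
      shifted_laplacian k (S N.+1) m + shifted_laplacian k (x N.+1) m.
    by rewrite SS /shifted_laplacian !ell2_addE; ring.
  have Lx : shifted_laplacian k (x N.+1) m = - (v m * x N m).
    transitivity (- shifted_laplacian k (G (w N)) m); last by rewrite LG wE.
    have xS n : x N.+1 n = - G (w N) n by [].
    by rewrite /shifted_laplacian !xS; ring.
  by rewrite LD IH Lx (SS N) ell2_addE; ring.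
pose K := D * l2norm y / (1 - th).
have XS N n : normc (X n - S N n) <= K * th ^+ N.
  apply: le_trans (XP N); rewrite -ell2_subE.
  exact: (l2norm_coord n (ell2P (X - S N))).
apply: (@eq_of_geometric _ th
  ((1 + 1 + normc (k + k^-1)) * (K * th) + C * K)) => // N.
have -> : shifted_laplacian k X m + v m * X m - y m =
    shifted_laplacian k (ell2_fun X - S N.+1) m + v m * (X m - S N m).
  by rewrite shifted_laplacianB SE; ring.
rewrite mulrDl; apply: le_trans (le_normcD _ _) _; apply: lerD.
  rewrite -mulrA -[K * th * _]mulrA -exprS.
  by apply: le_normc_shifted_laplacian => n; exact: XS.
by rewrite normcM -mulrA; apply: ler_pM; rewrite ?normc_ge0.
Qed.

Lemma resolvent_set_schroedinger :
  resolvent_set (schroedinger v) (k + k^-1).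
Proof.
pose T := HB.pack_for {linear ell2 R -> ell2 R} (schroedinger v)
  (GRing.isLinear.Build _ _ _ _ _ (schroedinger_linear p0 v_lp)).
have [K KP] := schroedinger_shift_surj.
apply: (@resolvent_set_bounded_inverse _ T _ K%:C%C).
- by rewrite complex_real.
- exact: schroedinger_shift_inj.
- move=> y; have [x [xy xK]] := KP y; exists x; split=> //.
  by rewrite -[`|y|]/((l2norm y)%:C%C) -rmorphM/= lecR.
Qed.

End resolvent.

(** * Row sums by Hoelder's inequality *)

Section hoelder.
Context {R : realType}.

(** Young's inequality for [a i / A] and [b i / B], summed. Positive upper bounds replace the norms,
    so that one pair serves all truncations. *)
Lemma sum_hoelder_le (I : Type) (r : seq I) (a b : I -> R) (p q A B : R) :
  0 < p -> 0 < q -> p^-1 + q^-1 = 1 -> 0 < A -> 0 < B ->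
  (forall i, 0 <= a i) -> (forall i, 0 <= b i) ->
  \sum_(i <- r) a i `^ p <= A `^ p -> \sum_(i <- r) b i `^ q <= B `^ q ->
  \sum_(i <- r) a i * b i <= A * B.
Proof.
move=> p0 q0 pq A0 B0 a0 b0 aA bB.
have norm (c : I -> R) C s : 0 < C -> 0 < s -> (forall i, 0 <= c i) ->
    \sum_(i <- r) c i `^ s <= C `^ s ->
    \sum_(i <- r) (c i / C) `^ s / s <= s^-1.
  move=> C0 s0 c0 cC; rewrite -mulr_suml ler_piMl ?invr_ge0 ?(ltW s0)//.
  under eq_bigr do rewrite powRM ?invr_ge0 ?(ltW C0)//.
  rewrite -mulr_suml -[C^-1]powR_inv1 ?(ltW C0)// powRAC powR_inv1 ?powR_ge0//.
  by rewrite ler_pdivrMr ?mul1r// powR_gt0.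
rewrite -[leRHS]mul1r -ler_pdivrMr ?mulr_gt0// mulr_suml -pq.
apply: le_trans (lerD (norm a A p A0 p0 a0 aA) (norm b B q B0 q0 b0 bB)).
rewrite -big_split /=; apply: ler_sum => i _.
have -> : a i * b i / (A * B) = (a i / A) * (b i / B).
  by rewrite invfM mulrACA.
by apply: conjugate_powR => //; rewrite divr_ge0// ltW.
Qed.

(** The displacements [n] and [-(n+1)] together contribute (1 + b) b^n. *)
Lemma sum_zrange_geometric_le (b : R) N : 0 <= b < 1 ->
  \sum_(j <- zrange N) b ^+ `|j| <= (1 + b) / (1 - b).
Proof.
move=> b01; have -> : \sum_(j <- zrange N) b ^+ `|j| =
    (1 + b) * \sum_(n < N) b ^+ n.
  elim: N => [|N IH]; first by rewrite big_nil big_ord0 mulr0.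
  rewrite zrangeS !big_cons IH big_ord_recr /= exprS; ring.
rewrite ler_wpM2l ?sum_geometric_le// addr_ge0//.
by case/andP: b01.
Qed.

Lemma sum_lpnorm_le (p B : R) (v : int -> R[i]) (s : seq int)
  (phi : int -> int) : 0 < p -> 0 <= B -> (lpnorm p%:E v <= B%:E)%E ->
  uniq s -> injective phi ->
  \sum_(j <- s) normc (v (phi j)) `^ p <= B `^ p.
Proof.
move=> p0 B0 vB us phi_inj.
rewrite -(big_map phi predT (fun n => normc (v n) `^ p)).
have : ((\sum_(n <- map phi s) normc (v n) `^ p)%:E <=
    \esum_(n in [set: int]) ((normc (v n)) `^ p)%:E)%E.
  apply: esum_ge; exists [set` map phi s].
    by split => //; exact: finite_seq.
  by rewrite -fsbig_seq ?map_inj_uniq// sumEFin.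
move: vB; rewrite /lpnorm.
set S := (\esum_(_ in _) _)%E; set T := \sum_(_ <- _) _ => SB TS.
have T0 : 0 <= T by apply: sumr_ge0 => n _; exact: powR_ge0.
have : (T%:E `^ p^-1 <= B%:E)%E.
  apply: le_trans SB; apply: gt0_ler_poweR => //.
  - by rewrite invr_ge0 ltW.
  - by rewrite in_itv/= lee_fin T0 leey.
  - by rewrite in_itv/= leey andbT (le_trans _ TS)// lee_fin.
rewrite lee_fin => TB.
rewrite -[T]powRr1// -[X in T `^ X](@mulVf _ p) ?gt_eqF// powRrM.
by apply: ge0_ler_powR; rewrite ?nnegrE ?powR_ge0// ltW.
Qed.

Lemma conj_exponent_gt0 (p : \bar R) : (1 < p)%E -> 0 < conj_exponent p.
Proof.
case: p => [p||]//; rewrite lte_fin => p1.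
by rewrite /conj_exponent divr_gt0 ?subr_gt0// (lt_trans _ p1).
Qed.

(** Hoelder's inequality, the q-th powers of [a ^+ |j|] being a two-sided geometric series of ratio
    a^q. For p = oo, where q = 1, the supremum is taken out of the sum directly. *)
Lemma sum_green_row_le (p : \bar R) (v : int -> R[i]) (a B : R) :
  (1 < p)%E -> 0 < a < 1 -> 0 < B -> (lpnorm p v <= B%:E)%E ->
  let q := conj_exponent p in
  forall N (phi : int -> int), injective phi ->
  \sum_(j <- zrange N) a ^+ `|j| * normc (v (phi j)) <=
    ((1 + a `^ q) / (1 - a `^ q)) `^ q^-1 * B.
Proof.
move=> p1 /andP[a0 a1] B0 vB q N phi phi_inj.
have q0 : 0 < q by exact: conj_exponent_gt0.
have b1 : a `^ q < 1.
  rewrite -[ltRHS](_ : 1 `^ q = 1); last by rewrite powR1.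
  by rewrite gt0_ltr_powR ?nnegrE// ltW.
set b := a `^ q in b1 *; have b0 : 0 <= b by exact: powR_ge0.
have A0 : 0 < (1 + b) / (1 - b).
  by rewrite divr_gt0 ?subr_gt0// addr_gt0 ?powR_gt0.
case: p => [p||] // in p1 vB q q0 b b1 b0 A0 *.
- rewrite lte_fin in p1; have p0 : 0 < p by exact: lt_trans p1.
  apply: (@sum_hoelder_le _ _ _ _ q p) => //.
  + rewrite /q /conj_exponent invf_div mulrBl mul1r mulfV ?gt_eqF//.
    by rewrite subrK.
  + exact: powR_gt0.
  + by move=> j; rewrite exprn_ge0// ltW.
  + by move=> j; exact: normc_ge0.
  + rewrite -powRrM mulVf ?gt_eqF// powRr1 ?(ltW A0)//.
    under eq_bigr do rewrite -powR_mulrn ?(ltW a0)// powRAC powR_mulrn//.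
    by rewrite -/b; apply: sum_zrange_geometric_le; rewrite b0.
  + by apply: sum_lpnorm_le => //; [exact: ltW|exact: zrange_uniq].
- rewrite /q /conj_exponent invr1 powRr1 ?(ltW A0)//.
  apply: (@le_trans _ _ (\sum_(j <- zrange N) a ^+ `|j| * B)).
    apply: ler_sum => j _; rewrite ler_wpM2l ?exprn_ge0 ?(ltW a0)//.
    rewrite -lee_fin; apply: le_trans vB; apply: ereal_sup_ubound.
    by exists (phi j).
  rewrite -mulr_suml ler_wpM2r ?(ltW B0)//.
  rewrite /b /q /conj_exponent powRr1 ?(ltW a0)//.
  by apply: sum_zrange_geometric_le; rewrite a1 ltW.
Qed.

Lemma lpnorm_ge0 (p : \bar R) (v : int -> R[i]) : (0 <= lpnorm p v)%E.
Proof.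
case: p => [p||] //=; first exact: poweR_ge0.
apply: (@le_trans _ _ (normc (v 0))%:E); first by rewrite lee_fin normc_ge0.
by apply: ereal_sup_ubound; exists 0.
Qed.

(** The roots of k^2 - z k + 1 = 0 have product 1, so one of them lies in the closed unit disc. *)
Lemma joukowski_preimage (z : R[i]) :
  exists k, [/\ k != 0, normc k <= 1 & k + k^-1 = z].
Proof.
pose k := (z + sqrtc (z ^+ 2 - 4)) / 2.
have kz : k * (z - k) = 1.
  have -> : k * (z - k) = (z ^+ 2 - sqrtc (z ^+ 2 - 4) ^+ 2) / 4.
    by rewrite /k; field.
  by rewrite sqr_sqrtc; field.
have k0 : k != 0.
  by apply/eqP => k0; move/eqP: kz; rewrite k0 mul0r eq_sym oner_eq0.
have kV : k^-1 = z - k by rewrite -[LHS]mulr1 -kz mulKf.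
have [k1|k1] := leP (normc k) 1.
  by exists k; split=> //; rewrite kV addrC subrK.
exists k^-1; split; rewrite ?invr_eq0// ?invrK ?kV ?subrK//.
by rewrite -kV normcV invf_le1 ?(lt_trans _ k1)// ltW.
Qed.

End hoelder.

(** * Localization of the spectrum *)

Theorem theorem2 (R : realType) (p : \bar R) (v : int -> R[i])
    (p_gt1 : (1 < p)%E) (v_lp : v \in lp p) :
  let q := conj_exponent p in
  spectrum (schroedinger v) `<=`
  [set k + k^-1 | k in [set k : R[i] |
    [/\ k != 0,
        normc k <= 1 &
        ((normc (k - k^-1)
          * ((1 - normc k `^ q) / (1 + normc k `^ q)) `^ q^-1)%:E
         <= lpnorm p v)%E]]].
Proof.
move=> q z z_spec; have [k [k0 k1 kz]] := joukowski_preimage z.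
have q0 : 0 < q by exact: conj_exponent_gt0.
exists k => //; split=> //; rewrite leNgt; apply/negP => vX.
apply: z_spec; rewrite -kz.
have p0 : (0 < p)%E by apply: lt_trans p_gt1; rewrite lte01.
(* For |k| = 1 the left side of the bound is 0, so the bound could not fail. *)
have {}k1 : normc k < 1.
  rewrite lt_neqAle k1 andbT; apply/eqP => k1'; move: vX.
  rewrite k1' powR1 subrr mul0r powR0 ?invr_eq0 ?gt_eqF// mulr0.
  by rewrite ltNge lpnorm_ge0.
have a0 : 0 < normc k.
  by rewrite lt_def normc_ge0 andbT; apply: contra_neq k0 => /eq0_normc.
have c0 : 0 < normc (k - k^-1).
  rewrite lt_def normc_ge0 andbT.
  by apply: contra_neq (subkVk_neq0 k0 k1) => /eq0_normc.
set X := _ * _ in vX.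
have Pfin : lpnorm p v \is a fin_num by rewrite ge0_fin_numE ?lpnorm_ge0.
pose P := fine (lpnorm p v).
have P0 : 0 <= P by rewrite fine_ge0// lpnorm_ge0.
have PX : P < X by rewrite -lte_fin fineK.
(* Strictly above the norm, [B] is positive even for v = 0; strictly below [X], it still gives a
   contraction. *)
pose B := (P + X) / 2.
have PB : P < B by rewrite /B; lra.
have BX : B < X by rewrite /B; lra.
have B0 : 0 < B by exact: le_lt_trans PB.
have vB : (lpnorm p v <= B%:E)%E by rewrite -(fineK Pfin) lee_fin ltW.
have row := @sum_green_row_le _ p v (normc k) B p_gt1 _ B0 vB.
pose b := normc k `^ q.
have b1 : b < 1.
  rewrite -[ltRHS](_ : 1 `^ q = 1); last by rewrite powR1.
  by rewrite gt0_ltr_powR ?nnegrE ?normc_ge0.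
have b0 : 0 <= b by exact: powR_ge0.
have b10 : 0 < 1 + b by rewrite (lt_le_trans ltr01)// lerDl.
pose A := ((1 + b) / (1 - b)) `^ q^-1.
have A0 : 0 < A by rewrite powR_gt0// divr_gt0// subr_gt0.
(* [A] is the reciprocal of the second factor of [X], so [B < X] says exactly that A B / |k - 1/k| <
   1. *)
have XA : A * X = normc (k - k^-1).
  rewrite /X mulrCA -powRM ?divr_ge0 ?subr_ge0 ?(ltW b1) ?(ltW b10)//.
  rewrite -/b mulrA divfK ?gt_eqF ?subr_gt0// mulfV ?gt_eqF//.
  by rewrite powR1 mulr1.
apply: (@resolvent_set_schroedinger _ p v p0 v_lp k k0 k1
  ((normc (k - k^-1))^-1 * (A * B))).
- by apply: mulr_gt0; [rewrite invr_gt0|exact: mulr_gt0].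
- by rewrite ltr_pdivrMl// mulr1 -XA ltr_pM2l.
- move=> N phi phi_inj; rewrite ler_wpM2l ?invr_ge0 ?normc_ge0//.
  by apply: row => //; rewrite a0.
Qed.
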